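(* Suppose $p_i=i$ for $i=0,1,\ldots,N$. Then for any $\xi\in\mathbf{R}^n$ and any $h,g>0$ we have $$\biggl|\biggl(\frac{c_{WW}(\xi)}{\sqrt{gh}}\biggr)^2-\biggl(\frac{c_{IK}(\xi)}{\sqrt{gh}}\biggr)^2\biggr|\leq C(h|\xi|)^{4[N/2]+2},$$ where $C$ is a positive constant depending only on $N$ and $[N/2]$ is the integer part of $N/2$.
   Context: $n\ge1$, $N\ge 1$ are integers; $g,h>0$. For integers $0=p_0<p_1<\cdots<p_N$ define the $(N+1)\times(N+1)$ matrices $$A_0=\Bigl(\frac{1}{p_i+p_j+1}\Bigr)_{0\le i,j\le N},\qquad A_1=\Bigl(\frac{p_ip_j}{p_i+p_j-1}\Bigr)_{0\le i,j\le N}$$ (with the convention $0/0=0$), $A(h\xi)=(h|\xi|)^2A_0+A_1$ for $\xi\in\mathbf{R}^n$, and, with $\mathbf{1}=(1,\ldots,1)^{\rm T}\in\mathbf{R}^{N+1}$, $$\tilde A(h\xi)=\begin{pmatrix}0&\mathbf{1}^{\rm T}\\-\mathbf{1}&A(h\xi)\end{pmatrix}.$$ The phase speed of the linearized Isobe--Kakinuma model (flat bottom) is $$c_{IK}(\xi)=\pm\sqrt{gh\,\frac{(h|\xi|)^{-2}\det A(h\xi)}{\det\tilde A(h\xi)}},$$ where $(h|\xi|)^{-2}\det A(h\xi)$ and $\det\tilde A(h\xi)$ are polynomials in $(h|\xi|)^2$ of degree $N$ and the value at $\xi=0$ is understood through these polynomials. The phase speed of linear water waves is $$c_{WW}(\xi)=\pm\sqrt{gh\,\frac{\tanh(h|\xi|)}{h|\xi|}},$$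 with $\tanh(s)/s$ read as $1$ at $s=0$. *)

(* Defs.v *)
From HB Require Import structures.
From mathcomp Require Import all_boot all_order all_algebra.
From mathcomp Require Import reals sequences exp.

Set Implicit Arguments.
Unset Strict Implicit.
Unset Printing Implicit Defensive.

Import Order.TTheory GRing.Theory Num.Theory.
Local Open Scope ring_scope.

(* The norm `|xi| that 'rV[R]_n carries in MathComp-Analysis is the sup norm,
   hence this separate definition. *)
Definition enorm (R : realType) (n : nat) (xi : 'rV[R]_n) : R :=
  Num.sqrt (\sum_(i < n) xi ord0 i ^+ 2).

Definition tanh (R : realType) (s : R) : R :=
  (expR s - expR (- s)) / (expR s + expR (- s)).

(* tanh s / s, extended by continuity *)
Definition tanhc (R : realType) (s : R) : R :=
  if s == 0 then 1 else tanh s / s.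

Section IsobeKakinuma.
Variables (R : realType) (N : nat) (p : 'I_N.+1 -> nat).

Definition A0 : 'M[R]_N.+1 :=
  \matrix_(i, j) ((p i)%:R + (p j)%:R + 1)^-1.

(* The subtraction of 1 takes place in R. The convention 0 / 0 = 0 is the
   library's x / 0 = 0; when the p_i are distinct, a zero
   denominator only occurs for {p_i, p_j} = {0, 1}. *)
Definition A1 : 'M[R]_N.+1 :=
  \matrix_(i, j) ((p i)%:R * (p j)%:R / ((p i)%:R + (p j)%:R - 1)).

(* A(h xi) as a function of s = h |xi| *)
Definition A (s : R) : 'M[R]_N.+1 := s ^+ 2 *: A0 + A1.

Definition bordered (S : pzRingType) (M : 'M[S]_N.+1) : 'M[S]_(1 + N.+1) :=
  block_mx 0 (const_mx 1) (const_mx (- 1)) M.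

(* A(h xi) with the indeterminate 'X in place of (h |xi|) ^ 2 *)
Definition Apoly : 'M[{poly R}]_N.+1 :=
  'X *: map_mx polyC A0 + map_mx polyC A1.

(* s^-2 det A(s) / det A~(s), numerator and denominator being read as
   polynomials in s ^ 2, so that s = 0 is meaningful; det A is a multiple
   of 'X as soon as p_0 = 0 (dvdp_det_Apoly). See also dispersionE. *)
Definition dispersion (s : R) : R :=
  (\det Apoly %/ 'X).[s ^+ 2] / (\det (bordered Apoly)).[s ^+ 2].

Lemma A_horner (s : R) : map_mx (horner_eval (s ^+ 2)) Apoly = A s.
Proof.
apply/matrixP=> i j; rewrite !mxE /horner_eval hornerD hornerM hornerX !hornerC.
by [].
Qed.

Lemma det_Apoly (s : R) : (\det Apoly).[s ^+ 2] = \det (A s).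
Proof. by rewrite -A_horner det_map_mx. Qed.

Lemma det_bordered_Apoly (s : R) :
  (\det (bordered Apoly)).[s ^+ 2] = \det (bordered (A s)).
Proof.
rewrite -A_horner -[LHS]/(horner_eval _ _) -det_map_mx /bordered.
rewrite (map_block_mx (horner_eval (s ^+ 2))) map_mx0 !map_const_mx.
by rewrite /horner_eval hornerN !hornerC.
Qed.

Lemma dvdp_det_Apoly : p ord0 = 0%N -> 'X %| \det Apoly.
Proof.
move=> p0; rewrite (expand_det_row _ ord0).
apply: (big_ind (fun q : {poly R} => 'X %| q)) => [|x y hx hy|j _].
- exact: dvdp0.
- by rewrite dvdp_addr.
- rewrite !mxE p0 /= !mul0r polyC0 addr0 -mulrA.
  exact: dvdp_mulr.
Qed.

Lemma dispersionE (s : R) : p ord0 = 0%N -> s != 0 ->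
  dispersion s = s ^- 2 * \det (A s) / \det (bordered (A s)).
Proof.
move=> p0 s0; rewrite /dispersion det_bordered_Apoly -det_Apoly.
rewrite -[in RHS](divpK (dvdp_det_Apoly p0)) hornerM hornerX.
by rewrite [_ * s ^+ 2]mulrC mulKf // expf_neq0.
Qed.

End IsobeKakinuma.

(* The boolean selects the branch of the sign +/-. Num.sqrt is 0 on negative
   numbers, but both radicands are positive: A0 is a positive definite Gram
   matrix, A1 is positive semidefinite, and det A~ = 1^T adj(A) 1. *)
Definition c_IK (R : realType) (N : nat) (p : 'I_N.+1 -> nat) (n : nat)
    (g h : R) (b : bool) (xi : 'rV[R]_n) : R :=
  (-1) ^+ b * Num.sqrt (g * h * dispersion p (h * enorm xi)).

Definition c_WW (R : realType) (n : nat)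
    (g h : R) (b : bool) (xi : 'rV[R]_n) : R :=
  (-1) ^+ b * Num.sqrt (g * h * tanhc (h * enorm xi)).

(* Main.v *)
Require Import Defs.
From mathcomp Require Import all_boot all_order all_algebra.
From mathcomp Require Import reals sequences exp.
From HB Require Import structures.
From mathcomp Require Import boolp functions.
From mathcomp Require Import topology normedtype derive realfun.
From mathcomp Require Import ring lra zify.

(** Write s for h|xi|, and let the energy of v on the unit interval be
    E(v) = int_0^1 (s^2 v^2 + v'^2).

    The matrix A(s) is the Gram matrix of the bilinear form E on the monomials
    1, z, ..., z^N. Hence the bordered linear system, solved by Cramer's rule,
    describes the minimiser q of E among the polynomials of degree at most N
    with q(1) = 1, and the ratio of the two determinants is the minimum E(q).
    Its quotient by s^2 is also the integral of q, which is how the value at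
    s = 0 is reached; see [galerkin].

    On the water-wave side, s tanh s is the minimum of the same energy over all
    smooth functions with value 1 at the endpoint 1, attained at
    cosh(sz) / cosh(s). This is the identity
      E(v) - s tanh(s) v(1)^2 = int_0^1 (v' - s tanh(sz) v)^2,
    which holds because z |-> s tanh(sz) solves the Riccati equation
    t' = s^2 - t^2; see [energy_riccati].

    So E(q) - s tanh(s) is nonnegative, and by minimality of q it is at most the
    right-hand side of the identity for any trial polynomial v with v(1) = 1.
    The natural choice is the Taylor polynomial of cosh(sz) of degree
    2 floor(N/2), divided by its value at 1: its residual v' - s tanh(sz) v is
    at most s^(2 floor(N/2) + 2) in absolute value ([cosh_poly_residual]).
    Squaring, which is where the doubled order of accuracy comes from, and
    dividing by s^2 gives the exponent 4 floor(N/2) + 2, with constant 1 and for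
    all s > 0. At s = 0 both sides are 0. *)

Import Order.TTheory GRing.Theory Num.Theory.
Import numFieldNormedType.Exports.
Local Open Scope ring_scope.

Set Implicit Arguments.
Unset Strict Implicit.
Unset Printing Implicit Defensive.

(** * Integration of polynomials over the unit interval and the energy form *)

Section Int01.
Context {R : realType}.
Implicit Types (p q u v : {poly R}) (s x : R).

(** The coefficient in degree 0 is a division by zero, hence 0: this is the
    antiderivative vanishing at 0. *)
Definition antideriv p : {poly R} := \poly_(i < (size p).+1) (p`_i.-1 / i%:R).

Lemma coef_antideriv p i : (antideriv p)`_i = p`_i.-1 / i%:R.
Proof.
rewrite coef_poly; case: ltnP => // hi.
case: i hi => [|i] hi; first by rewrite invr0 mulr0.
by rewrite nth_default ?mul0r.
Qed.

Lemma deriv_antideriv p : (antideriv p)^`() = p.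
Proof.
apply/polyP => i; rewrite coef_deriv coef_antideriv /= -[LHS]mulr_natr divfK //.
by rewrite pnatr_eq0.
Qed.

Lemma antideriv_at0 p : (antideriv p).[0] = 0.
Proof. by rewrite horner_coef0 coef_antideriv invr0 mulr0. Qed.

Definition int01 p : R := (antideriv p).[1].

Lemma int01_is_linear : linear int01.
Proof.
move=> a p q; rewrite /int01.
suff -> : antideriv (a *: p + q) = a *: antideriv p + antideriv q.
  by rewrite hornerD hornerZ.
apply/polyP => i; rewrite !(coefD, coefZ, coef_antideriv).
by rewrite mulrDl mulrA.
Qed.

HB.instance Definition _ :=
  GRing.isLinear.Build R {poly R} R *%R int01 int01_is_linear.

Lemma int01Xn n : int01 'X^n = n.+1%:R^-1.
Proof.
rewrite /int01.
suff -> : antideriv 'X^n = n.+1%:R^-1 *: 'X^(n.+1).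
  by rewrite hornerZ hornerXn expr1n mulr1.
apply/polyP => -[|i]; rewrite coef_antideriv coefZ !coefXn /=.
  by rewrite invr0 !mulr0.
by rewrite eqSS; case: eqP => [->|]; rewrite ?mul0r ?mulr0 ?mul1r ?mulr1.
Qed.

(** The mean value theorem for the difference of an antiderivative of [p] and
    [w]. It lets integrals be computed for polynomials only: comparing the
    integral of p - w' with 0, or with an upper bound, needs just the pointwise
    values of the integrand. *)
Lemma int01_MVT p (w dw : R -> R) : (forall x : R, is_derive x 1 w (dw x)) ->
  exists2 c, 0 <= c <= 1 & int01 p - (w 1 - w 0) = p.[c] - dw c.
Proof.
move=> dwP.
pose f : R -> R := horner (antideriv p) - w.
have fP x : is_derive x 1 f (p.[x] - dw x).
  have h := @is_derive_poly R (antideriv p) x; rewrite deriv_antideriv in h.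
  exact: is_deriveB.
have [|c c01 fE] :=
    @MVT_segment R f (fun x => p.[x] - dw x) 0 1 ler01 (fun x _ => fP x).
  apply: continuous_subspaceT => x.
  by apply/differentiable_continuous/derivable1_diffP; case: (fP x).
exists c; first by move: c01; rewrite in_itv.
move: fE; rewrite /f -[(_ - _) 1]/(_ - _) -[(_ - _) 0]/(_ - _) antideriv_at0.
rewrite /int01 subr0 mulr1 => <-; ring.
Qed.

Lemma int01_ge0 p : (forall x, 0 <= p.[x]) -> 0 <= int01 p.
Proof.
move=> p0; have [c _] := int01_MVT p (fun x => is_derive_cst 0 x 1).
by rewrite /cst !subr0 => ->.
Qed.

(** The antiderivative of p^2 is nondecreasing and takes the same value at 0 and
    1, so it is constant on the unit interval; having infinitely many roots, it
    is the zero polynomial. *)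
Lemma int01_sqr_eq0 p : int01 (p ^+ 2) = 0 -> p = 0.
Proof.
move=> I0; set P := antideriv (p ^+ 2).
have Pmono x y : 0 <= x -> x <= y -> y <= 1 -> P.[x] <= P.[y].
  apply: (@ger0_derive1_ndecr R (horner P) 0 1).
  - by move=> z _; exact: derivable_horner.
  - move=> z _; rewrite derive1E.
    have h := @is_derive_poly R P z.
    by rewrite derive_val deriv_antideriv horner_exp sqr_ge0.
  - by apply: continuous_subspaceT => z; exact: continuous_horner.
have P0 x : 0 <= x <= 1 -> P.[x] = 0.
  case/andP=> x0 x1; apply/le_anti/andP; split.
    by rewrite -I0; apply: Pmono.
  by rewrite -(antideriv_at0 (p ^+ 2)); apply: Pmono.
suff P_eq0 : P = 0.
  apply/eqP; rewrite -sqrf_eq0 -(deriv_antideriv (p ^+ 2)) -/P P_eq0.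
  by rewrite deriv0.
apply/eqP/negPn/negP => Pn0.
(* More roots than the degree allows: 1, 1/2, 1/3, and so on. *)
pose rs := [seq (k.+1%:R : R)^-1 | k <- iota 0 (size P)].
suff : (size rs < size P)%N by rewrite size_map size_iota ltnn.
apply: max_poly_roots => //.
  apply/allP => _ /mapP[k _ ->]; apply/rootP/P0.
  by rewrite invr_ge0 ler0n invf_le1 ?ltr0n // ler1n.
rewrite map_inj_uniq ?iota_uniq // => i j /invr_inj /eqP.
by rewrite eqr_nat eqSS => /eqP.
Qed.

Definition energy s u v : R := int01 (s ^+ 2 *: (u * v) + u^`() * v^`()).

Lemma energyC s u v : energy s u v = energy s v u.
Proof. by rewrite /energy [u * v]mulrC [u^`() * _]mulrC. Qed.

Lemma energy_is_linear s u : linear (energy s u).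
Proof.
move=> a p q; rewrite /energy -linearP; congr int01.
rewrite derivD derivZ !mulrDr -!scalerAr !scalerDr !scalerA.
by rewrite [a * _]mulrC addrACA.
Qed.

HB.instance Definition _ s u :=
  GRing.isLinear.Build R {poly R} R *%R (energy s u) (energy_is_linear s u).

Lemma energy_ge0 s u : 0 <= energy s u u.
Proof.
apply: int01_ge0 => x; rewrite hornerD hornerZ !hornerM -!expr2.
by apply: addr_ge0; rewrite ?sqr_ge0 // mulr_ge0 ?sqr_ge0.
Qed.

Lemma energy_eq0 s u : energy s u u = 0 -> u^`() = 0.
Proof.
rewrite /energy linearD linearZ /= -!expr2 => h.
apply: int01_sqr_eq0; apply/eqP; rewrite eq_le; apply/andP; split; last first.
  by apply: int01_ge0 => x; rewrite horner_exp sqr_ge0.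
have : 0 <= s ^+ 2 * int01 (u ^+ 2).
  rewrite mulr_ge0 ?sqr_ge0 //; apply: int01_ge0 => x.
  by rewrite horner_exp sqr_ge0.
by move: h; set I1 := int01 _; set I2 := int01 _; lra.
Qed.

Lemma deriv_eq0 u : u^`() = 0 -> u = (u.[1])%:P.
Proof.
move=> du; suff /size1_polyC -> : (size u <= 1)%N by rewrite hornerC.
apply/leq_sizeP => -[//|j] _.
have /eqP : (u^`())`_j = 0 by rewrite du coef0.
by rewrite coef_deriv mulrn_eq0 /= => /eqP.
Qed.

Lemma poly_expand n v : (size v <= n)%N -> v = \sum_(i < n) v`_i *: 'X^i.
Proof.
move=> sv; apply/polyP => i; rewrite -poly_def coef_poly.
by case: ltnP => // h; rewrite nth_default // (leq_trans sv).
Qed.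

(** When i + j = 1 the true integral of the product of derivatives is 0, which
    agrees with the division by zero in the last term. *)
Lemma energyXn s i j :
  energy s 'X^i 'X^j =
  s ^+ 2 * (i%:R + j%:R + 1)^-1 + i%:R * j%:R / (i%:R + j%:R - 1).
Proof.
rewrite /energy linearD linearZ /= -exprD int01Xn -natrD natr1; congr (_ + _).
rewrite !derivXn mulrnAl mulrnAr -exprD !raddfMn /= int01Xn.
case: i => [|i]; first by rewrite !mulr0n !mul0r.
case: j => [|j]; first by rewrite mulr0n mul0rn mulr0 mul0r.
rewrite /= -mulrnA -[LHS]mulr_natr [LHS]mulrC mulnC natrM; congr (_ / _).
by rewrite addSn addnS -[_.+2%:R]natr1 addrK.
Qed.

End Int01.

(** * The Galerkin solution behind the determinants *)

Lemma size_sumXn {R : realType} n (a : 'I_n -> R) :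
  (size (\sum_(i < n) a i *: 'X^i)%R <= n)%N.
Proof.
apply: (leq_trans (size_sum _ _ _)); apply/bigmax_leqP => i _.
by apply: (leq_trans (size_scale_leq _ _)); rewrite size_polyXn.
Qed.

Lemma coef_sumXn {R : realType} n (a : 'I_n -> R) (j : 'I_n) :
  (\sum_(i < n) a i *: 'X^i)`_j = a j.
Proof.
rewrite coef_sum (bigD1 j) //= coefZ coefXn eqxx mulr1 big1 ?addr0 // => i ij.
by rewrite coefZ coefXn eq_sym val_eqE (negbTE ij) mulr0.
Qed.

Section Galerkin.
Context {R : realType} (N : nat) (p : 'I_N.+1 -> nat).
Hypothesis pE : forall i, p i = i :> nat.
Implicit Types (s : R) (u v : {poly R}).

Lemma A_energy s i j : A p s i j = energy s 'X^i 'X^j.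
Proof. by rewrite energyXn !mxE !pE. Qed.

Lemma energy_sum s (a : 'I_N.+1 -> R) j :
  energy s (\sum_(i < N.+1) a i *: 'X^i) 'X^j = \sum_i a i * energy s 'X^i 'X^j.
Proof.
rewrite energyC linear_sum; apply: eq_bigr => i _.
by rewrite linearZ energyC.
Qed.

Lemma energy_test s u c : (forall j : 'I_N.+1, energy s u 'X^j = c) ->
  forall v, (size v <= N.+1)%N -> energy s u v = c * v.[1].
Proof.
move=> h v sv; rewrite (poly_expand sv) linear_sum horner_sum mulr_sumr.
apply: eq_bigr => j _.
by rewrite linearZ /= h hornerZ hornerXn expr1n mulr1 mulrC.
Qed.

(** A row vector (v0, v1) in the kernel encodes a polynomial q with q(1) = 0
    whose energy pairing with every v of degree at most N is -v0 v(1). Testing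
    with v = q gives E(q) = 0, so q is constant, hence zero, and so is v0.
    The argument covers s = 0, where [A p s] itself is singular. *)
Lemma det_bordered_neq0 s : \det (bordered (A p s)) != 0.
Proof.
apply/negP => /det0P[v].
rewrite -(hsubmxK v); move: (lsubmx v) (rsubmx v) => v0 v1 v_neq0.
rewrite /bordered mul_row_block mulmx0 add0r -row_mx0 => /eq_row_mx[h1 h2].
pose q : {poly R} := \sum_(i < N.+1) v1 0 i *: 'X^i.
have sq : (size q <= N.+1)%N by exact: size_sumXn.
have q1 : q.[1] = 0.
  move/matrixP/(_ 0 0): h1; rewrite !mxE => /eqP.
  under eq_bigr do rewrite mxE mulrN1.
  rewrite sumrN oppr_eq0 => /eqP h1.
  rewrite /q horner_sum -[RHS]h1; apply: eq_bigr => i _.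
  by rewrite hornerZ hornerXn expr1n mulr1.
have qX (j : 'I_N.+1) : energy s q 'X^j = - v0 0 0.
  move/matrixP/(_ 0 j): h2; rewrite !mxE big_ord1 !mxE mulr1.
  under eq_bigr do rewrite A_energy.
  by rewrite energy_sum => /eqP; rewrite addrC addr_eq0 => /eqP.
have q_eq0 : q = 0.
  have := energy_test qX sq; rewrite q1 mulr0 => /energy_eq0/deriv_eq0 ->.
  by rewrite q1.
have v1_eq0 : v1 = 0.
  by apply/rowP => i; rewrite mxE -(coef_sumXn (v1 0) i) -/q q_eq0 coef0.
have v0_eq0 : v0 = 0.
  apply/rowP => i; rewrite mxE ord1; apply/eqP; rewrite -oppr_eq0 -(qX ord0).
  by rewrite q_eq0 energyC linear0.
by move: v_neq0; rewrite v0_eq0 v1_eq0 row_mx0 eqxx.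
Qed.

Lemma Apoly_row0 k : Apoly R p ord0 k = 'X * (k.+1%:R^-1)%:P.
Proof. by rewrite !mxE !pE /= !mul0r polyC0 addr0 add0r natr1. Qed.

(** Cramer's rule for the bordered system with the first unit vector as right
    hand side, kept over the polynomial ring: [b] is the lower part of the first
    column of the adjugate, whose top entry is the determinant of [Apoly R p].
    Since p_0 = 0, the row of index 0 of [Apoly R p] is 'X times a constant row,
    so 'X can be cancelled before evaluation; this gives the last identity,
    which remains meaningful at s = 0. *)
Lemma galerkin_adj : exists b : 'cV[{poly R}]_N.+1,
  [/\ \sum_k b k 0 = \det (bordered (Apoly R p)),
      forall i, \sum_k Apoly R p i k * b k 0 = \det (Apoly R p) &
      \det (Apoly R p) %/ 'X = \sum_(k < N.+1) (k.+1%:R^-1)%:P * b k 0].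
Proof.
set K := bordered _; set M := Apoly R p.
pose c := lsubmx (\adj K); pose a := usubmx c; pose b := dsubmx c.
have aE : a 0 0 = \det M.
  rewrite /a /c !mxE /cofactor /= addn0 expr0 mul1r.
  have liftE (k : 'I_N.+1) : lift (lshift N.+1 (0 : 'I_1)) k = rshift 1 k.
    exact: val_inj.
  congr (\det _); apply/matrixP => i j.
  by rewrite [LHS]mxE [LHS]mxE !liftE /K /bordered block_mxEdr.
have /eqP : K *m c = lsubmx (\det K)%:M.
  by rewrite /c mulmx_lsub mul_mx_adj.
rewrite -[c]vsubmxK -/a -/b {1}/K /bordered mul_block_col mul0mx add0r.
rewrite scalar_mx_block block_mxEh row_mxKl => /eqP/eq_col_mx[h1 h2].
clearbody a b; have e i : \sum_k M i k * b k 0 = \det M.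
  move/matrixP/(_ i 0): h2; rewrite !mxE big_ord1 !mxE mulN1r aE => /eqP.
  by rewrite addrC subr_eq0 => /eqP.
exists b; split => //.
  move/matrixP/(_ 0 0): h1; rewrite !mxE mulr1n => <-.
  by apply: eq_bigr => k _; rewrite mxE mul1r.
apply: (@mulfI _ 'X); first by rewrite polyX_eq0.
rewrite mulrC divpK ?dvdp_det_Apoly ?pE // -(e ord0) mulr_sumr.
by apply: eq_bigr => k _; rewrite Apoly_row0 mulrA.
Qed.

(** The polynomial q is the constrained minimiser of the energy and
    s^2 * dispersion is its Lagrange multiplier, equal to the minimum E(q) by
    taking v = q. The integral formula comes from v = 1 divided by s^2, the
    division being made on polynomials. *)
Lemma galerkin s : exists q : {poly R},
  [/\ (size q <= N.+1)%N, q.[1] = 1, int01 q = dispersion p s &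
      forall v, (size v <= N.+1)%N ->
        energy s q v = s ^+ 2 * dispersion p s * v.[1]].
Proof.
have [b [b1 bM bX]] := galerkin_adj.
set D := (\det (bordered (Apoly R p))).[s ^+ 2].
have D0 : D != 0 by rewrite /D det_bordered_Apoly det_bordered_neq0.
pose a k := (b k 0).[s ^+ 2] / D.
pose q : {poly R} := \sum_(k < N.+1) a k *: 'X^k.
have sq : (size q <= N.+1)%N by exact: size_sumXn.
have q1 : q.[1] = 1.
  rewrite /q horner_sum -[RHS](divff D0) {1}/D -b1 horner_sum mulr_suml.
  by apply: eq_bigr => k _; rewrite hornerZ hornerXn expr1n mulr1.
have qI : int01 q = dispersion p s.
  rewrite /dispersion bX -/D /q linear_sum horner_sum mulr_suml.
  apply: eq_bigr => k _; rewrite linearZ /= int01Xn hornerM hornerC.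
  by rewrite mulrC mulrA.
have qX (j : 'I_N.+1) : energy s q 'X^j = (\det (Apoly R p)).[s ^+ 2] / D.
  rewrite /q energy_sum -(bM j) horner_sum mulr_suml.
  apply: eq_bigr => k _.
  rewrite hornerM -[(Apoly R p j k).[_]]/(horner_eval _ _).
  have /matrixP/(_ j k) := A_horner p s; rewrite mxE => ->.
  by rewrite A_energy energyC mulrC mulrA.
exists q; split => // v sv.
rewrite (energy_test qX sv) -qI; congr (_ * _).
rewrite -(qX ord0) /energy /= expr0 -polyC1 derivC mulr0 addr0 mulr1.
by rewrite linearZ.
Qed.

End Galerkin.

(** * Hyperbolic functions: the Riccati identity and the trial polynomial *)

Section Hyperbolic.
Context {R : realType}.
Implicit Types (s x y z : R) (v : {poly R}).

(* Twice the hyperbolic cosine and sine. *)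
Let ch x : R := expR x + expR (- x).
Let sh x : R := expR x - expR (- x).

Lemma ch_gt0 x : 0 < ch x.
Proof. by rewrite addr_gt0 ?expR_gt0. Qed.

Lemma ch_le x y : 0 <= x -> x <= y -> ch x <= ch y.
Proof.
move=> x0 xy; rewrite -subr_ge0.
have -> : ch y - ch x = (expR y - expR x) * (1 - expR (- x) * expR (- y)).
  have := expRxMexpNx_1 x; have := expRxMexpNx_1 y.
  rewrite /ch; move: (expR x) (expR y) (expR (- x)) (expR (- y)).
  move=> a b c d h1 h2.
  have -> : (b - a) * (1 - c * d) = b - a - (b * d) * c + (a * c) * d by ring.
  by rewrite h1 h2; ring.
rewrite mulr_ge0 // subr_ge0 ?ler_expR // -expRD -expR0 ler_expR; lra.
Qed.

Lemma is_derive_expRM s x :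
  is_derive x 1 (fun z => expR (s * z)) (s * expR (s * x)).
Proof.
have h : is_derive x 1 (fun z : R => s * z) s.
  have := @is_deriveZ R R R id s x 1 1 (is_derive_id x 1).
  by rewrite /GRing.scale /= mulr1.
have := @is_derive1_comp R expR (fun z : R => s * z) x _ _ (is_derive_expR _) h.
by rewrite mulrC.
Qed.

Lemma is_derive_ch s x : is_derive x 1 (fun z => ch (s * z)) (s * sh (s * x)).
Proof.
have := is_deriveD (is_derive_expRM s x) (is_derive_expRM (- s) x).
rewrite (_ : _ + _ = (fun z => ch (s * z))); last first.
  by apply/funext => z; rewrite /ch -mulNr.
by rewrite (_ : _ + _ = s * sh (s * x)) // /sh -[in RHS]mulNr; ring.
Qed.

Lemma is_derive_sh s x : is_derive x 1 (fun z => sh (s * z)) (s * ch (s * x)).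
Proof.
have := is_deriveB (is_derive_expRM s x) (is_derive_expRM (- s) x).
rewrite (_ : _ - _ = (fun z => sh (s * z))); last first.
  by apply/funext => z; rewrite /sh -mulNr.
by rewrite (_ : _ - _ = s * ch (s * x)) // /ch -[in RHS]mulNr; ring.
Qed.

Lemma is_derive_tanh s x :
  is_derive x 1 (fun z => tanh (s * z)) (s * (1 - tanh (s * x) ^+ 2)).
Proof.
have C0 : ch (s * x) != 0 by rewrite gt_eqF ?ch_gt0.
have h : is_derive x 1 (fun z => tanh (s * z)) _ :=
  is_deriveM (is_derive_sh s x)
  (@is_deriveV R (fun z => ch (s * z)) x _ 1 C0 (is_derive_ch s x)).
apply: (is_derive_eq h); rewrite -[tanh _]/(sh _ / ch _) /GRing.scale /=.
by field.
Qed.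

(** Since t(z) = s tanh(sz) satisfies t' = s^2 - t^2 and t(0) = 0, the integrand
    s^2 v^2 + v'^2 is (v' - t v)^2 plus the derivative of t v^2. The mean value
    point c stands for the integral of the square over the unit interval. *)
Lemma energy_riccati s v : exists2 c, 0 <= c <= 1 &
  energy s v v - s * tanh s * v.[1] ^+ 2 =
  (v^`().[c] - s * tanh (s * c) * v.[c]) ^+ 2.
Proof.
pose w z : R := s * tanh (s * z) * v.[z] ^+ 2.
pose dw z : R := s * (s * (1 - tanh (s * z) ^+ 2)) * v.[z] ^+ 2
               + s * tanh (s * z) * (2 * v.[z] * v^`().[z]).
have wP x : is_derive x 1 w (dw x).
  have h1 := is_deriveZ s (is_derive_tanh s x).
  have h2 := is_deriveX 2 (is_derive_poly v x).
  have h : is_derive x 1 w _ := is_deriveM h1 h2.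
  apply: (is_derive_eq h); rewrite /dw /GRing.scale /= /GRing.scale /=.
  by rewrite -[(horner v ^+ 2) x]/(v.[x] ^+ 2); ring.
have [c c01 E] := int01_MVT (s ^+ 2 *: (v * v) + v^`() * v^`()) wP.
exists c => //; move: E; rewrite /w mulr1 mulr0.
have -> : @tanh R 0 = 0 by rewrite /tanh oppr0 subrr mul0r.
rewrite mulr0 mul0r subr0 -/(energy s v v) => ->.
by rewrite /dw hornerD hornerZ !hornerM; ring.
Qed.

(** The Taylor polynomial of z |-> cosh(sz) of degree 2m. *)
Definition cosh_poly s m : {poly R} :=
  \sum_(k < m.+1) (s ^+ (2 * k) / (2 * k)`!%:R) *: 'X^(2 * k).

Lemma size_cosh_poly s m : (size (cosh_poly s m) <= (2 * m).+1)%N.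
Proof.
apply: (leq_trans (size_sum _ _ _)); apply/bigmax_leqP => i _.
apply: (leq_trans (size_scale_leq _ _)).
by rewrite size_polyXn ltnS leq_mul2l -ltnS ltn_ord.
Qed.

Lemma cosh_poly_ge1 s m : 1 <= (cosh_poly s m).[1].
Proof.
rewrite horner_sum big_ord_recl /= hornerZ hornerXn !expr1n !mulr1.
rewrite muln0 expr0 fact0 invr1 mulr1 lerDl sumr_ge0 // => i _.
rewrite hornerZ hornerXn expr1n mulr1 divr_ge0 //.
by rewrite exprM exprn_ge0 ?sqr_ge0.
Qed.

Lemma deriv_cosh_poly0 s m : (cosh_poly s m)^`().[0] = 0.
Proof.
rewrite horner_coef0 coef_deriv mulr1n coef_sum big1 // => k _.
rewrite coefZ coefXn; case: (nat_of_ord k) => [|j]; first by rewrite mulr0.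
by rewrite mul2n doubleS mulr0.
Qed.

(** Differentiating twice shifts the Taylor series by one term, so that the
    equation T'' = s^2 T of the hyperbolic cosine fails only by the last one. *)
Lemma deriv2_cosh_poly s m : (cosh_poly s m)^`()^`() =
  s ^+ 2 *: cosh_poly s m - (s ^+ (2 * m).+2 / (2 * m)`!%:R) *: 'X^(2 * m).
Proof.
rewrite /cosh_poly; elim: m => [|m IH].
  rewrite big_ord_recr big_ord0 /= add0r muln0 !expr0 fact0 divr1 scale1r.
  by rewrite -polyC1 !derivC invr1 mulr1 subrr.
rewrite big_ord_recr !derivD IH /= scalerDr scalerA.
have -> : s ^+ 2 * (s ^+ (2 * m.+1) / (2 * m.+1)`!%:R)
        = s ^+ (2 * m.+1).+2 / (2 * m.+1)`!%:R by rewrite mulrA -exprD add2n.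
rewrite addrK -[RHS]addr0 -addrA; congr (_ + _).
apply/eqP; rewrite addr_eq0 eqr_opp eq_sym; apply/eqP.
rewrite !derivZ !derivXn mulnS !add2n /= derivMn derivXn /=.
rewrite -mulrnA -[X in _ *: X]scaler_nat scalerA.
congr (_ *: _); rewrite !factS !natrM.
field; apply/and3P; split;
  rewrite -?natrM ?nat1r -?natrD pnatr_eq0 -?lt0n ?fact_gt0 //.
Qed.

(** Multiplied by cosh(sz), the residual becomes G = T' cosh(sz) - s T sinh(sz).
    It vanishes at 0 and its derivative (T'' - s^2 T) cosh(sz) reduces to the
    top Taylor term times cosh(sz). The mean value theorem bounds G(c) by that
    term times cosh(sc), because cosh is increasing on [0, oo), and the factor
    cosh(sc) cancels. *)
Lemma cosh_poly_residual s m c : 0 <= s -> 0 <= c <= 1 ->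
  `|(cosh_poly s m)^`().[c] - s * tanh (s * c) * (cosh_poly s m).[c]|
  <= s ^+ (2 * m).+2.
Proof.
move=> s0 /andP[c0 c1]; set T := cosh_poly s m.
pose r : R := s ^+ (2 * m).+2 / (2 * m)`!%:R.
pose G z : R := T^`().[z] * ch (s * z) - s * sh (s * z) * T.[z].
pose dG z : R := - (r * z ^+ (2 * m) * ch (s * z)).
have GP x : is_derive x 1 G (dG x).
  have h1 := is_deriveM (is_derive_poly T^`() x) (is_derive_ch s x).
  have h2 := is_deriveM (is_deriveZ s (is_derive_sh s x)) (is_derive_poly T x).
  have h : is_derive x 1 G _ := is_deriveB h1 h2.
  apply: (is_derive_eq h); rewrite /dG /GRing.scale /= /GRing.scale /=.
  rewrite deriv2_cosh_poly -/r -/T hornerD hornerN !hornerZ hornerXn.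
  by ring.
have [|d d0c GE] := @MVT_segment R G dG 0 c c0 (fun x _ => GP x).
  apply: continuous_subspaceT => x.
  by apply/differentiable_continuous/derivable1_diffP; case: (GP x).
move: d0c; rewrite in_itv /= => /andP[d0 dc].
have G0 : G 0 = 0.
  rewrite /G deriv_cosh_poly0 mulr0 /sh oppr0 subrr; ring.
rewrite G0 !subr0 in GE.
have C0 := ch_gt0 (s * c).
have -> : T^`().[c] - s * tanh (s * c) * T.[c] = G c / ch (s * c).
  rewrite /G -[tanh _]/(sh _ / ch _); field.
  by rewrite gt_eqF.
rewrite normrM normfV (gtr0_norm C0) ler_pdivrMr // GE /dG mulNr normrN.
have r0 : 0 <= r by rewrite divr_ge0 ?exprn_ge0.
have Cd := ltW (ch_gt0 (s * d)).
have L0 : 0 <= r * d ^+ (2 * m) * ch (s * d).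
  by apply: mulr_ge0 => //; apply: mulr_ge0 => //; apply: exprn_ge0.
rewrite ger0_norm; last exact: mulr_ge0.
have CC : ch (s * d) <= ch (s * c).
  by apply: ch_le; rewrite ?mulr_ge0 ?ler_wpM2l.
have rs : r <= s ^+ (2 * m).+2.
  rewrite ler_pdivrMr ?ltr0n ?fact_gt0 // ler_peMr ?exprn_ge0 //.
  by rewrite ler1n fact_gt0.
have dm : d ^+ (2 * m) <= 1 by rewrite exprn_ile1 // (le_trans dc).
rewrite -[leRHS]mulr1; apply: ler_pM => //.
apply: ler_pM => //; first by apply: mulr_ge0 => //; apply: exprn_ge0.
by rewrite -[leRHS]mulr1; apply: ler_pM => //; apply: exprn_ge0.
Qed.

End Hyperbolic.

(** * Comparison of the two dispersion relations *)

Section Comparison.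
Context {R : realType} (N : nat) (p : 'I_N.+1 -> nat).
Hypothesis pE : forall i, p i = i :> nat.
Implicit Types (s : R) (v : {poly R}).

(** At s = 0 the energy of q is 0, so q is the constant 1. *)
Lemma dispersion0 : dispersion p (0 : R) = 1.
Proof.
have [q [sq q1 <- qE]] := galerkin pE (0 : R).
have := qE q sq; rewrite expr0n mul0r mul0r => /energy_eq0/deriv_eq0 ->.
by rewrite q1 polyC1 -(expr0 'X) int01Xn invr1.
Qed.

(** The stationary point q is a minimiser because E(v - q) >= 0. *)
Lemma dispersion_le_energy s v : (size v <= N.+1)%N -> v.[1] = 1 ->
  s ^+ 2 * dispersion p s <= energy s v v.
Proof.
move=> sv v1; have [q [sq q1 _ qE]] := galerkin pE s.
have := energy_ge0 s (v - q).
rewrite linearB /= 2![energy s (v - q) _]energyC !linearB /=.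
rewrite [energy s v q]energyC.
by rewrite !qE // v1 q1 mulr1; lra.
Qed.

Lemma tanh_le_dispersion s : s * tanh s <= s ^+ 2 * dispersion p s.
Proof.
have [q [sq q1 _ qE]] := galerkin pE s.
have [c _] := energy_riccati s q; rewrite qE // q1 expr1n !mulr1 => E.
by rewrite -subr_ge0 E sqr_ge0.
Qed.

(** The trial polynomial is the Taylor polynomial of cosh(sz) normalised at 1;
    its even degree 2 floor(N/2) is the largest one not exceeding N. *)
Lemma dispersion_le_tanh s : 0 <= s ->
  s ^+ 2 * dispersion p s <= s * tanh s + s ^+ (4 * N./2 + 4).
Proof.
move=> s0; set T := cosh_poly s N./2.
have T1 : 1 <= T.[1] := cosh_poly_ge1 s N./2.
have T0 : 0 < T.[1] := lt_le_trans ltr01 T1.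
pose v := T.[1]^-1 *: T.
have v1 : v.[1] = 1 by rewrite hornerZ mulVf ?gt_eqF.
have sv : (size v <= N.+1)%N.
  apply: (leq_trans (size_scale_leq _ _)).
  apply: (leq_trans (size_cosh_poly _ _)).
  by rewrite ltnS mul2n -geq_half_double.
apply: (le_trans (dispersion_le_energy s sv v1)).
have [c c01] := energy_riccati s v; rewrite v1 expr1n mulr1 => E.
rewrite addrC -lerBlDr E derivZ !hornerZ mulrCA -mulrBr.
have -> : (4 * N./2 + 4 = (2 * N./2).+2 * 2)%N by lia.
rewrite exprM -[leLHS]real_normK ?num_real // ler_sqr ?nnegrE ?exprn_ge0 //.
rewrite normrM -[leRHS]mul1r ler_pM // ?cosh_poly_residual //.
by rewrite ger0_norm ?invf_le1 // invr_ge0 ltW.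
Qed.

Lemma tanhcE s : s != 0 -> s ^+ 2 * tanhc s = s * tanh s.
Proof. by move=> s0; rewrite /tanhc (negbTE s0); field. Qed.

Lemma dispersion_approx s : 0 <= s ->
  `|tanhc s - dispersion p s| <= s ^+ (4 * N./2 + 2).
Proof.
rewrite le_eqVlt => /predU1P[<-|s0].
  by rewrite dispersion0 /tanhc eqxx subrr normr0 expr0n addn2.
have s2 : 0 < s ^+ 2 by rewrite exprn_gt0.
have sn0 : s != 0 by rewrite gt_eqF.
rewrite distrC ger0_norm; last first.
  by rewrite subr_ge0 -(ler_pM2l s2) tanhcE // tanh_le_dispersion.
rewrite -(ler_pM2l s2) mulrBr tanhcE // -exprD lerBlDl.
by rewrite (addnC 2%N) -addnA dispersion_le_tanh // ltW.
Qed.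

Lemma tanhc_ge0 s : 0 <= s -> 0 <= tanhc s.
Proof.
move=> s0; rewrite /tanhc; case: eqP => // _.
apply: divr_ge0 => //; apply: divr_ge0; last by rewrite addr_ge0 ?expR_ge0.
by rewrite subr_ge0 ler_expR; lra.
Qed.

Lemma dispersion_ge0 s : 0 <= dispersion p s.
Proof.
have [->|s0] := eqVneq s 0; first by rewrite dispersion0.
have [q [sq q1 _ qE]] := galerkin pE s.
have s2 : 0 < s ^+ 2 by rewrite exprn_even_gt0.
rewrite -(ler_pM2l s2) mulr0; have := energy_ge0 s q.
by rewrite qE // q1 mulr1.
Qed.

End Comparison.

Lemma sqr_speed (R : realType) (a t : R) (b : bool) : 0 < a -> 0 <= t ->
  ((-1) ^+ b * Num.sqrt (a * t) / Num.sqrt a) ^+ 2 = t.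
Proof.
move=> a0 t0; rewrite expr_div_n exprMn sqrr_sign mul1r.
have a_ge0 := ltW a0; rewrite !sqr_sqrtr ?mulr_ge0 //.
by rewrite mulrAC divff ?mul1r // gt_eqF.
Qed.

Unset Implicit Arguments.

Theorem theorem3 (R : realType) (N : nat) (hN : (1 <= N)%N) :
  exists C : R, 0 < C /\
    forall (p : 'I_N.+1 -> nat), (forall i : 'I_N.+1, p i = i :> nat) ->
    forall (n : nat), (1 <= n)%N ->
    forall (xi : 'rV[R]_n) (h g : R), 0 < h -> 0 < g ->
    forall b b' : bool,
      `|(c_WW g h b xi / Num.sqrt (g * h)) ^+ 2
        - (c_IK p g h b' xi / Num.sqrt (g * h)) ^+ 2|
      <= C * (h * enorm xi) ^+ (4 * N./2 + 2)%N.
Proof.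
exists 1; split=> // p pE n _ xi h g h0 g0 b b'.
have s0 : 0 <= h * enorm xi by rewrite mulr_ge0 ?sqrtr_ge0 ?ltW.
have gh0 : 0 < g * h by rewrite mulr_gt0.
rewrite /c_WW /c_IK !sqr_speed ?tanhc_ge0 ?dispersion_ge0 //.
by rewrite mul1r dispersion_approx.
Qed.
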